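(* Let $\Gamma_0$ and $\Gamma_1$ be countable groups and let $K$ be a nontrivial second countable compact group equipped with its normalized Haar measure. Assume that for $i = 0,1$ the action $\Gamma_i \curvearrowright K^{\Gamma_i}/K$ is isomorphic with the Bernoulli action $\Gamma_i \curvearrowright Y_i^{\Gamma_i}$ with base space a standard probability space $(Y_i,\mu_i)$. Write $G := \Gamma_0 * \Gamma_1$. Then $G \curvearrowright K^{G}/K$ is isomorphic with the Bernoulli action $G \curvearrowright (Y_0 \times Y_1)^{G}$ with base space $Y_0 \times Y_1$.
   Context: P.m.p. means probability measure preserving. For a countable group $\Gamma$ and a standard probability space $(X_0,\mu_0)$, the Bernoulli action of $\Gamma$ with base space $(X_0,\mu_0)$ is the action $\Gamma \curvearrowright X_0^\Gamma$ (product probability measure) given by $(g\cdot x)_h = x_{hg}$ for $g,h \in \Gamma$, $x \in X_0^\Gamma$. The compact group $K$ acts on $K^\Gamma$ by diagonal left translation $(k\cdot x)_h = k x_h$; this commutes with the Bernoulli action. $K^\Gamma/K$ is the quotient space equipped with the push-forward of the product Haar measure, and $\Gamma \curvearrowright K^\Gamma/K$ is the induced p.m.p. action. The space $Y_0\times Y_1$ carries the product measure $\mu_0\times\mu_1$. A probability space isomorphism is a measure preserving Borel bijection between conegligible subsets. Two p.m.p. actions $\Gamma \curvearrowright (X_0,\mu_0)$, $\Gamma \curvearrowright (X_1,\mu_1)$ of the same group are isomorphic if there is a probability space isomorphism $\Delta : X_0 \to X_1$ with $\Delta(g\cdot x) = g\cdot\Delta(x)$ for all $g\in\Gamma$ and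 a.e. $x \in X_0$. *)

(* Defs.v *)
From HB Require Import structures.
From mathcomp Require Import all_boot all_order all_algebra finmap.
From mathcomp Require Import all_classical all_reals all_analysis.

Set Implicit Arguments.
Unset Strict Implicit.
Unset Printing Implicit Defensive.

Import Order.TTheory GRing.Theory Num.Theory.

Local Open Scope group_scope.

(* The free product of G0 and G1 is realized as the group of reduced words:
   words in the disjoint union of G0 and G1 without trivial letters, in which
   consecutive letters come from different factors. *)
Section ReducedWords.
Variables G0 G1 : groupType.
Local Notation letter := (G0 + G1)%type.
Implicit Types (l m : letter) (u v w : seq letter).

Definition side l : bool := if l is inl _ then false else true.

Definition trivial_letter l : bool :=
  match l with inl g => g == 1 | inr g => g == 1 end.

Definition inv_letter l : letter :=
  match l with inl g => inl g^-1 | inr g => inr g^-1 end.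

Definition reduced w : bool :=
  all (fun l => ~~ trivial_letter l) w &&
  sorted (fun l m => side l != side m) w.

(* The reduced form of l :: w when w is reduced. *)
Definition lmul l w : seq letter :=
  match l, w with
  | inl g, inl h :: w' => if g * h == 1 then w' else inl (g * h) :: w'
  | inr g, inr h :: w' => if g * h == 1 then w' else inr (g * h) :: w'
  | _, _ => if trivial_letter l then w else l :: w
  end.

Definition wmul u v : seq letter := foldr lmul v u.

Definition winv w : seq letter := rev (map inv_letter w).

Lemma reduced_behead l w : reduced (l :: w) -> reduced w.
Proof.
by rewrite /reduced /= => /andP[/andP[_ ->]] /path_sorted ->.
Qed.

Lemma reduced_lmul l w : reduced w -> reduced (lmul l w).
Proof.
case: l w => g [|[h|h] w] rw /=.
- by case: ifP => // g1; rewrite /reduced /= g1.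
- case: ifP => [_|gh1]; first exact: reduced_behead rw.
  by move: rw; rewrite /reduced /= gh1; case/andP => /andP[_ ->]; case: (w).
- by case: ifP => // g1; move: rw; rewrite /reduced /= g1.
- by case: ifP => // g1; rewrite /reduced /= g1.
- by case: ifP => // g1; move: rw; rewrite /reduced /= g1.
- case: ifP => [_|gh1]; first exact: reduced_behead rw.
  by move: rw; rewrite /reduced /= gh1; case/andP => /andP[_ ->]; case: (w).
Qed.

Lemma reduced_wmul u v : reduced v -> reduced (wmul u v).
Proof. by move=> rv; elim: u => //= l u; apply: reduced_lmul. Qed.

Lemma lmul_cons l w : reduced (l :: w) -> lmul l w = l :: w.
Proof.
by case: l w => g [|[h|h] w] //=; rewrite /reduced /= ?andbF //;
   case/andP => /andP[/negPf->].
Qed.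

Lemma lmul_trivial l w : reduced w -> trivial_letter l -> lmul l w = w.
Proof.
by case: l w => g [|[h|h] w] rw //= /eqP->; rewrite ?eqxx // mul1g ifN //;
   case/andP: rw => /andP[].
Qed.

Lemma lmul_inl g h w : reduced w ->
  lmul (inl (g * h)) w = lmul (inl g) (lmul (inl h) w).
Proof.
case: w => [|[k|k] w] rw /=; last 1 first.
- by have [->|h1] := eqVneq h 1; rewrite ?mulg1.
- by have [->|h1] := eqVneq h 1; rewrite ?mulg1.
have [hk|hk] := eqVneq (h * k) 1; last by rewrite /= mulgA.
rewrite -mulgA hk mulg1; case: w rw => [|[m|m] w] //.
by rewrite /reduced /= andbF.
Qed.

Lemma lmul_inr g h w : reduced w ->
  lmul (inr (g * h)) w = lmul (inr g) (lmul (inr h) w).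
Proof.
case: w => [|[k|k] w] rw /=.
- by have [->|h1] := eqVneq h 1; rewrite ?mulg1.
- by have [->|h1] := eqVneq h 1; rewrite ?mulg1.
have [hk|hk] := eqVneq (h * k) 1; last by rewrite /= mulgA.
rewrite -mulgA hk mulg1; case: w rw => [|[m|m] w] //.
by rewrite /reduced /= andbF.
Qed.

Lemma wmul_lmul l v w : reduced v -> reduced w ->
  wmul (lmul l v) w = lmul l (wmul v w).
Proof.
have triv m u : trivial_letter m -> reduced u -> u = lmul m u.
  by move=> *; rewrite lmul_trivial.
move=> rv rw; have rvw := reduced_wmul v rw.
case: l v rv rvw => g [|[h|h] v] rv rvw; rewrite {1}/lmul.
- by case: ifP => // g1; exact: triv.
- have {}rvw := reduced_wmul v rw.
  rewrite -[RHS]lmul_inl //; by case: ifP => // gh1; exact: triv.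
- by case: ifP => // g1; exact: triv.
- by case: ifP => // g1; exact: triv.
- by case: ifP => // g1; exact: triv.
- have {}rvw := reduced_wmul v rw.
  rewrite -[RHS]lmul_inr //; by case: ifP => // gh1; exact: triv.
Qed.

Lemma wmulA u v w : reduced v -> reduced w ->
  wmul u (wmul v w) = wmul (wmul u v) w.
Proof.
by move=> rv rw; elim: u => //= l u ->; rewrite wmul_lmul // reduced_wmul.
Qed.

Lemma wmul1 w : reduced w -> wmul w [::] = w.
Proof.
elim: w => //= l w IHw rlw.
by rewrite IHw ?lmul_cons //; apply: reduced_behead rlw.
Qed.

Lemma inv_letterK : involutive inv_letter.
Proof. by case=> g /=; rewrite invgK. Qed.

Lemma winvK : involutive winv.
Proof.
by move=> w; rewrite /winv map_rev revK -map_comp map_id_in // => l _;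
   apply: inv_letterK.
Qed.

Lemma reduced_winv w : reduced w -> reduced (winv w).
Proof.
case/andP=> aw sw; apply/andP; split.
  rewrite all_rev all_map; apply: sub_all aw => -[g|g] /=; by rewrite invg_eq1.
rewrite rev_sorted sorted_map; apply: sub_sorted sw => -[g|g] [h|h] //=.
Qed.

Lemma wmulV w : reduced w -> wmul (winv w) w = [::].
Proof.
elim: w => //= l w IHw rlw.
rewrite /winv /= rev_cons /wmul foldr_rcons -/(wmul _ _).
rewrite -[RHS]IHw ?(reduced_behead rlw) //; congr wmul.
by case: l rlw => g _ /=; rewrite mulVg eqxx.
Qed.

End ReducedWords.

Record freeprod (G0 G1 : groupType) := FreeProd {
  fpword :> seq (G0 + G1);
  fpwordP : reduced fpword
}.

HB.instance Definition _ (G0 G1 : groupType) := [isSub for @fpword G0 G1].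
HB.instance Definition _ (G0 G1 : groupType) :=
  [Choice of freeprod G0 G1 by <:].

Section FreeProduct.
Variables G0 G1 : groupType.
Implicit Types x y z : freeprod G0 G1.

Definition fpone : freeprod G0 G1 := @FreeProd G0 G1 [::] isT.
Definition fpmul x y := FreeProd (reduced_wmul x (fpwordP y)).
Definition fpinv x := FreeProd (reduced_winv (fpwordP x)).

Fact fpmulA : associative fpmul.
Proof.
by move=> x y z; apply: val_inj; apply: wmulA; apply: fpwordP.
Qed.

Fact fpmul1 : left_id fpone fpmul. Proof. by move=> x; apply: val_inj. Qed.

Fact fpmulr1 : right_id fpone fpmul.
Proof. by move=> x; apply: val_inj; apply: wmul1; apply: fpwordP. Qed.

Fact fpmulV : left_inverse fpone fpinv fpmul.
Proof. by move=> x; apply: val_inj; apply: wmulV; apply: fpwordP. Qed.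

Fact fpmulrV : right_inverse fpone fpinv fpmul.
Proof.
move=> x; have {1}-> : x = fpinv (fpinv x).
  by apply: val_inj; rewrite /= winvK.
exact: fpmulV.
Qed.

HB.instance Definition _ := isGroup.Build (freeprod G0 G1)
  fpmulA fpmul1 fpmulr1 fpmulV fpmulrV.

Definition fpinl (g : G0) : freeprod G0 G1 :=
  FreeProd (@reduced_lmul G0 G1 (inl g) [::] isT).
Definition fpinr (g : G1) : freeprod G0 G1 :=
  FreeProd (@reduced_lmul G0 G1 (inr g) [::] isT).

Lemma fpinlM : {morph fpinl : g h / g * h}.
Proof.
move=> g h; apply: val_inj.
rewrite -[LHS]/(lmul (inl (g * h)) [::]) lmul_inl //.
by rewrite -[RHS]/(wmul (lmul (inl g) [::]) (fpinl h)) wmul_lmul // fpwordP.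
Qed.

Lemma fpinrM : {morph fpinr : g h / g * h}.
Proof.
move=> g h; apply: val_inj.
rewrite -[LHS]/(lmul (inr (g * h)) [::]) lmul_inr //.
by rewrite -[RHS]/(wmul (lmul (inr g) [::]) (fpinr h)) wmul_lmul // fpwordP.
Qed.

Theorem freeprod_universal (H : groupType) (f0 : G0 -> H) (f1 : G1 -> H) :
  {morph f0 : g h / g * h} -> {morph f1 : g h / g * h} ->
  exists f : freeprod G0 G1 -> H,
    [/\ {morph f : x y / x * y}, f \o fpinl =1 f0, f \o fpinr =1 f1 &
        forall f' : freeprod G0 G1 -> H, {morph f' : x y / x * y} ->
          f' \o fpinl =1 f0 -> f' \o fpinr =1 f1 -> f' =1 f].
Proof.
move=> f0M f1M.
have m1 (A : groupType) (k : A -> H) : {morph k : g h / g * h} -> k 1 = 1.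
  by move=> kM; apply: (mulgI (k 1)); rewrite -kM !mulg1.
pose fl (l : G0 + G1) := match l with inl g => f0 g | inr g => f1 g end.
pose fw (w : seq (G0 + G1)) := foldr (fun l h => fl l * h) 1 w.
have fl1 l : trivial_letter l -> fl l = 1.
  by case: l => g /eqP ->; rewrite /= m1.
have fwl l w : fw (lmul l w) = fl l * fw w.
  case: l w => g [|[h|h] w]; rewrite /lmul.
  all: try by case: ifP => // /fl1 ->; rewrite mul1g.
  - rewrite -[fw (_ :: w)]/(f0 h * fw w) mulgA -f0M.
    by case: eqP => [->|//]; rewrite (m1 _ _ f0M) mul1g.
  - rewrite -[fw (_ :: w)]/(f1 h * fw w) mulgA -f1M.
    by case: eqP => [->|//]; rewrite (m1 _ _ f1M) mul1g.
exists (fun x => fw x); split.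
- by case=> u ru y /=; elim: u {ru} => [|l u IHu] /=;
    rewrite ?mul1g // fwl IHu mulgA.
- by move=> g; rewrite -[LHS]/(fw (lmul (inl g) [::])) fwl mulg1.
- by move=> g; rewrite -[LHS]/(fw (lmul (inr g) [::])) fwl mulg1.
move=> f' f'M e0 e1 [w rw] /=; elim: w rw => [|l w IHw] rw.
  by rewrite (_ : FreeProd _ = 1) ?m1 //; apply: val_inj.
have rw' := reduced_behead rw.
have -> : FreeProd rw =
    (match l with inl g => fpinl g | inr g => fpinr g end) * FreeProd rw'.
  apply: val_inj; rewrite [LHS]/= -[LHS]lmul_cons //; case: l {rw} => g.
    by rewrite -[RHS]/(wmul (lmul (inl g) [::]) w) wmul_lmul.
  by rewrite -[RHS]/(wmul (lmul (inr g) [::]) w) wmul_lmul.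
by rewrite f'M (IHw rw'); case: l {rw} => g /=; rewrite -?e0 -?e1.
Qed.

End FreeProduct.

Local Open Scope classical_set_scope.

HB.mixin Record isTopGroup K & Group K & Topological K := {
  mulg_continuous : continuous (fun z : K * K => z.1 * z.2) ;
  invg_continuous : continuous (fun x : K => x^-1)
}.

#[short(type="topGroupType")]
HB.structure Definition TopGroup :=
  {K of isTopGroup K & Group K & Topological K}.

Definition borel (K : topGroupType) : Type := K.

Definition borel_display : measure_display. Proof. exact. Qed.

Section Borel.
Variable K : topGroupType.
HB.instance Definition _ := TopGroup.on (borel K).
HB.instance Definition _ := isPointed.Build (borel K) 1.

Let borel_open : set (set (borel K)) := @open K.

HB.instance Definition _ :=
  @isMeasurable.Build borel_display (borel K) <<s borel_open >>
    (@sigma_algebra0 _ setT borel_open) (@sigma_algebraC _ borel_open)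
    (@sigma_algebra_bigcup _ setT borel_open).
End Borel.

(* Left invariance; the normalization comes from m being a probability. *)
Definition is_haar (R : realType) (K : topGroupType)
    (m : set (borel K) -> \bar R) : Prop :=
  forall (k : borel K) (A : set (borel K)), measurable A ->
    m ((fun x => k * x) @` A) = m A.

(* Y is standard Borel: its sigma-algebra is, up to a bijection, the Borel
   sigma-algebra of a Polish space. *)
Definition standard_borel (R : realType) d (Y : measurableType d) : Prop :=
  exists (S : completePseudoMetricType R) (f : Y -> S),
    [/\ hausdorff_space S, @second_countable S, bijective f &
        forall A : set Y, measurable A <-> <<s @open S >> (f @` A)].

(* An alias of I -> T, to carry the product sigma-algebra. *)
Definition prodspace (I T : Type) : Type := I -> T.

Definition prodspace_display : measure_display -> measure_display.
Proof. exact. Qed.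

Section ProductSpace.
Context (I : Type) d (T : measurableType d).
HB.instance Definition _ := Pointed.copy (prodspace I T) (I -> T).

Let cylinders : set (set (prodspace I T)) :=
  \bigcup_i preimage_set_system setT (fun x : prodspace I T => x i) measurable.

HB.instance Definition _ :=
  @isMeasurable.Build (prodspace_display d) (prodspace I T) <<s cylinders >>
    (@sigma_algebra0 _ setT cylinders) (@sigma_algebraC _ cylinders)
    (@sigma_algebra_bigcup _ setT cylinders).
End ProductSpace.

(* P is the product measure mu^I: it is determined by its values on the
   cylinder sets. *)
Definition is_product_measure (R : realType) (I : choiceType) d
    (T : measurableType d) (mu : set T -> \bar R)
    (P : set (prodspace I T) -> \bar R) : Prop :=
  forall (J : {fset I}) (A : I -> set T), (forall i, measurable (A i)) ->
    P [set x | forall i, i \in J -> A i (x i)] = (\prod_(i <- J) mu (A i))%E.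

Definition bernoulli (G : groupType) (T : Type) (g : G) (x : prodspace G T) :
  prodspace G T := fun h => x (h * g).

Lemma bernoulli1 (G : groupType) (T : Type) (x : prodspace G T) :
  bernoulli 1 x = x.
Proof. by apply/funext => h; rewrite /bernoulli mulg1. Qed.

Lemma bernoulliM (G : groupType) (T : Type) (g h : G) (x : prodspace G T) :
  bernoulli (g * h) x = bernoulli g (bernoulli h x).
Proof. by apply/funext => k; rewrite /bernoulli mulgA. Qed.

Section DiagonalQuotient.
Variables (G : groupType) (K : topGroupType).
Local Notation KG := (prodspace G (borel K)).

Definition diag_act (k : K) (x : KG) : KG := fun h => (k : borel K) * x h.

Definition same_orbit (x y : KG) : bool := `[< exists k : K, y = diag_act k x >].

Fact same_orbit_refl : reflexive same_orbit.
Proof.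
by move=> x; apply/asboolP; exists 1; apply/funext => h; rewrite /diag_act mul1g.
Qed.

Fact same_orbit_sym : symmetric same_orbit.
Proof.
have H x y : same_orbit x y -> same_orbit y x.
  move=> /asboolP[k ->]; apply/asboolP; exists k^-1; apply/funext => h.
  by rewrite /diag_act mulKg.
by move=> x y; apply/idP/idP; apply: H.
Qed.

Fact same_orbit_trans : transitive same_orbit.
Proof.
move=> y x z /asboolP[k ->] /asboolP[l ->]; apply/asboolP; exists (l * k).
by apply/funext => h; rewrite /diag_act mulgA.
Qed.

Canonical same_orbit_equiv :=
  EquivRel same_orbit same_orbit_refl same_orbit_sym same_orbit_trans.

Local Open Scope quotient_scope.

Definition diag_quot : Type := {eq_quot same_orbit}.
HB.instance Definition _ := Choice.on diag_quot.
HB.instance Definition _ := EqQuotient.on diag_quot.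

Definition diag_pi (x : KG) : diag_quot := \pi_diag_quot x.

HB.instance Definition _ := isPointed.Build diag_quot (diag_pi point).

Let quot_measurable : set (set diag_quot) :=
  image_set_system setT diag_pi measurable.

Let quot_sigma_algebra : sigma_algebra setT quot_measurable :=
  sigma_algebra_image diag_pi (@sigma_algebra_measurable _ KG).

Let quot0 : quot_measurable set0.
Proof. by case: quot_sigma_algebra. Qed.

Let quotC A : quot_measurable A -> quot_measurable (~` A).
Proof. by case: quot_sigma_algebra => _ C _ /C; rewrite setTD. Qed.

Let quotU (F : (set diag_quot)^nat) : (forall i, quot_measurable (F i)) ->
  quot_measurable (\bigcup_i F i).
Proof. by case: quot_sigma_algebra => _ _ U; exact: U. Qed.

Definition diag_quot_display : measure_display. Proof. exact. Qed.

HB.instance Definition _ :=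
  @isMeasurable.Build diag_quot_display diag_quot quot_measurable quot0 quotC quotU.

Fact measurable_diag_pi : measurable_fun [set: KG] diag_pi.
Proof. by move=> _ A; exact. Qed.

HB.instance Definition _ := isMeasurableFun.Build _ _ _ _ diag_pi measurable_diag_pi.

(* Independent of the representative, by quot_actE. *)
Definition quot_act (g : G) (q : diag_quot) : diag_quot :=
  diag_pi (bernoulli g (repr q)).

Lemma diag_piP (x y : KG) :
  diag_pi x = diag_pi y <-> exists k : K, y = diag_act k x.
Proof.
by split=> [/eqmodP/asboolP//|kxy]; apply/eqmodP/asboolP.
Qed.

Lemma quot_actE (g : G) (x : KG) :
  quot_act g (diag_pi x) = diag_pi (bernoulli g x).
Proof.
have /diag_piP[k xE] : diag_pi (repr (diag_pi x)) = diag_pi x by exact: reprK.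
by apply/diag_piP; exists k; rewrite [in LHS]xE.
Qed.

End DiagonalQuotient.

Definition quot_prob (R : realType) (G : groupType) (K : topGroupType)
    (P : probability (prodspace G (borel K)) R) : probability (diag_quot G K) R :=
  distribution P (@diag_pi G K).

Definition conegligible (R : realType) d (X : measurableType d)
    (P : probability X R) (A : set X) : Prop :=
  measurable A /\ P (~` A) = 0%E.

(* D only matters on A0; its values elsewhere are junk. The inverse bijection
   is required to be Borel too, which on standard Borel spaces is automatic. *)
Definition probability_iso (R : realType) d0 d1 (X0 : measurableType d0)
    (X1 : measurableType d1) (P0 : probability X0 R) (P1 : probability X1 R)
    (D : X0 -> X1) : Prop :=
  exists (A0 : set X0) (A1 : set X1),
    [/\ conegligible P0 A0 /\ conegligible P1 A1,
        set_bij A0 A1 D,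
        measurable_fun A0 D,
        (forall B, B `<=` A0 -> measurable B -> measurable (D @` B)) &
        forall B, measurable B -> P0 (A0 `&` D @^-1` B) = P1 B].

Definition isomorphic_actions (R : realType) (G : groupType) d0 d1
    (X0 : measurableType d0) (X1 : measurableType d1)
    (P0 : probability X0 R) (a0 : G -> X0 -> X0)
    (P1 : probability X1 R) (a1 : G -> X1 -> X1) : Prop :=
  exists D : X0 -> X1, probability_iso P0 P1 D /\
    forall g, {ae P0, forall x, D (a0 g x) = a1 g (D x)}.

(* Main.v *)
Require Import Defs.
From HB Require Import structures.
From mathcomp Require Import all_boot all_order all_algebra finmap.
From mathcomp Require Import all_classical all_reals all_analysis.
From mathcomp Require Import measurable_realfun.

(* Let F_i x be the coordinate at 1 of the image in Y_i^(G_i) of the class of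
   x in K^(G_i)/K.  The isomorphism for G = G0 * G1 sends the class of x in K^G
   to the family of pairs (F0, F1) evaluated at the restrictions to G0 and G1 of
   the translates g.x, g in G.

   The labels found along a coset of G_i encode x on that coset up to left
   translation.  Every element of G is reached from 1 by one coset step for each
   letter of its reduced word, so the labels determine x^-1(1) x(g), and this is
   how the inverse map is built.

   For the measure: two cosets of the factors meet in at most one element u, the
   shortest one of one of the two.  By left invariance of Haar measure, an event
   invariant under left translation by K and carried by a coset c remains
   independent of the coordinates outside c even when one coordinate of c is
   added to them.  Adding the cosets by increasing length thus makes them
   mutually independent, and on each coset the labels are those of the given
   isomorphism for G_i. *)

Set Implicit Arguments.
Unset Strict Implicit.
Unset Printing Implicit Defensive.

Import Order.TTheory.

Local Open Scope classical_set_scope.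
Local Open Scope group_scope.

(** * Measurability and product measures *)

Section Countable.
Context (I : Type) d (T : measurableType d) (cI : countable [set: I]).

Lemma measurable_forall (F : I -> set T) :
  (forall i, measurable (F i)) -> measurable [set x | forall i, F i x].
Proof.
move=> mF.
rewrite (_ : [set x | _] = ~` \bigcup_(i in [set: I]) ~` F i).
  by apply/measurableC/countable_bigcupT_measurable => // i; apply/measurableC.
rewrite setC_bigcup; apply/seteqP; split => x Fx i; first by rewrite setCK.
by have := Fx i Logic.I; rewrite setCK.
Qed.

Lemma negligible_exists (R : realType) (P : {measure set T -> \bar R}%R)
    (F : I -> set T) :
  (forall i, P.-negligible (F i)) -> P.-negligible [set x | exists i, F i x].
Proof.
move=> nF; have /countable_injP[f f_inj] := cI.
pose G n : set T := [set x | exists2 i, f i = n & F i x].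
have nG n : P.-negligible (G n).
  have [[i fin]|nf] := pselect (exists i, f i = n).
    apply: negligibleS (nF i) => x [j fjn Fjx].
    by rewrite (_ : i = j) //; apply: f_inj; rewrite ?inE // fin fjn.
  rewrite (_ : G n = set0); first exact: negligible_set0.
  by apply/seteqP; split => x // [i fin _]; apply: nf; exists i.
apply: negligibleS (negligible_bigcup nG) => x [i Fix].
by exists (f i) => //; exists i.
Qed.
End Countable.

Lemma measure_setI_conull (R : realType) d (T : measurableType d)
    (P : {measure set T -> \bar R}%R) (A C : set T) :
  measurable A -> measurable C -> P.-negligible (~` A) -> P (A `&` C) = P C.
Proof.
move=> mA mC nA; have mCA : measurable (C `\` A) by exact: measurableD.
rewrite -[in RHS](setUIDK C A) setIC measureU0 //; first exact: measurableI.
by apply: measure_negligible => //; apply: negligibleS nA => x [].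
Qed.

Section ProductSpace.
Context (I : Type) d (T : measurableType d).

Lemma measurable_proj (i : I) :
  measurable_fun [set: prodspace I T] (fun x => x i).
Proof.
move=> _ A mA; rewrite setTI; apply: sub_sigma_algebra.
by exists i => //; exists A => //; rewrite setTI.
Qed.

Lemma measurable_funPi d' (U : measurableType d') (f : U -> prodspace I T) :
  (forall i, measurable_fun setT (fun u => f u i)) -> measurable_fun setT f.
Proof.
move=> mf; apply: measurability => // A.
case=> B [i _ [C mC <-]] <-; rewrite !setTI.
by have := mf i measurableT C mC; rewrite setTI.
Qed.
End ProductSpace.

Section Cylinders.
Context (I : choiceType) d (T : measurableType d).
Local Open Scope ereal_scope.

Lemma measurable_cylinder (J : {fset I}) (A : I -> set T) :
  (forall i, measurable (A i)) ->
  measurable [set x : prodspace I T | forall i, i \in J -> A i (x i)].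
Proof.
move=> mA.
rewrite (_ : [set x | _] =
    \bigcap_(i in [set` J]) ((fun x : prodspace I T => x i) @^-1` A i)) //.
apply: fin_bigcap_measurable; first exact: finite_fset.
by move=> i _; rewrite -[X in measurable X]setTI; exact: measurable_proj.
Qed.

(** Cylinders with sides in a generating pi-system [C] form a generating pi-system of the product
    space. A general [C] is allowed so that rectangles suffice when [T] is a product such as
    [Y0 * Y1]. *)
Lemma cylinder_unique (R : realType) (C : set (set T)) :
  measurable = <<s C >> -> setI_closed C -> C setT ->
  forall P Q : {measure set (prodspace I T) -> \bar R}%R, P setT < +oo ->
  (forall (J : {fset I}) A, (forall i, C (A i)) ->
    P [set x | forall i, i \in J -> A i (x i)] =
    Q [set x | forall i, i \in J -> A i (x i)]) ->
  forall E, measurable E -> P E = Q E.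
Proof.
move=> CE CI CT P Q Pfin PQ.
pose Cyl : set (set (prodspace I T)) := [set E | exists (J : {fset I}) A,
  (forall i, C (A i)) /\ E = [set x | forall i, i \in J -> A i (x i)]].
have CylT : Cyl setT.
  by exists fset0, (fun=> setT); split => //; apply/seteqP; split.
have CM A : C A -> measurable A by rewrite CE; exact: sub_sigma_algebra.
apply: (measure_unique Cyl (fun=> setT)) => //; last 2 first.
- by apply/seteqP; split => // x _; exists 0%N.
- by move=> _ [J [A [CA ->]]]; exact: PQ.
- apply/seteqP; split; last first.
    apply: smallest_sub; first exact: sigma_algebra_measurable.
    move=> _ [J [A [CA ->]]]; apply: measurable_cylinder => i; exact: CM.
  apply: smallest_sub; first exact: smallest_sigma_algebra.
  move=> _ [i _ [A mA <-]].
  suff : <<s preimage_set_system setT (fun x : prodspace I T => x i) C >>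
      `<=` <<s Cyl >>.
    apply; rewrite g_sigma_preimageE; exists A => //.
    by move: mA; rewrite CE.
  apply: sub_sigma_algebra2 => _ [B CB <-].
  exists [fset i]%fset, (fun=> B); split => //; apply/seteqP; split.
    by move=> x [_ Bx] j; rewrite inE => /eqP->.
  by move=> x Bx; split => //; apply: Bx; rewrite inE.
- move=> _ _ [J [A [CA ->]]] [L [B [CB ->]]].
  (* Padding with [setT] puts both cylinders over a common index set. *)
  exists (J `|` L)%fset, (fun i => (if i \in J then A i else setT) `&`
    (if i \in L then B i else setT)); split.
    by move=> i; apply: CI; case: ifP.
  apply/seteqP; split => x.
    by move=> [Ax Bx] i _; split; case: ifP => //; [exact: Ax|exact: Bx].
  move=> ABx; split=> i iJ; have := ABx i; rewrite inE iJ ?orbT => /(_ isT) [].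
    by [].
  by [].
Qed.

Lemma product_measure_unique_cyl (R : realType) (mu : set T -> \bar R)
    (P Q : probability (prodspace I T) R) :
  is_product_measure mu P -> is_product_measure mu Q ->
  forall E, measurable E -> P E = Q E.
Proof.
move=> Pmu Qmu; apply: (@cylinder_unique R measurable) => //.
- by apply/esym/sigma_algebra_id; exact: sigma_algebra_measurable.
- by move=> *; exact: measurableI.
- by move=> *; rewrite (le_lt_trans (probability_le1 P _)) ?ltry.
- by move=> J A mA; exact: etrans (Pmu J A mA) (esym (Qmu J A mA)).
Qed.
End Cylinders.

Definition coord_map (I J T : Type) (f : I -> J) (x : prodspace J T) :
  prodspace I T := fun i => x (f i).

Lemma measurable_coord_map (I J : Type) d (T : measurableType d) (f : I -> J) :
  measurable_fun setT (@coord_map I J T f).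
Proof. by apply: measurable_funPi => i; exact: measurable_proj. Qed.

Section Reindex.
Context (R : realType) (I J : choiceType) d (T : measurableType d).
Variables (f : I -> J) (mu : probability T R).
Variables (P : probability (prodspace J T) R) (Q : probability (prodspace I T) R).
Hypotheses (f_inj : injective f) (Pmu : is_product_measure mu P)
  (Qmu : is_product_measure mu Q).

Lemma product_measure_coord_map E : measurable E -> P (coord_map f @^-1` E) = Q E.
Proof.
pose X : {mfun prodspace J T >-> prodspace I T} :=
  HB.pack (@coord_map I J T f) (isMeasurableFun.Build _ _ _ _ _ (measurable_coord_map f)).
move=> mE; rewrite -[LHS]/(distribution P X E).
apply: (product_measure_unique_cyl (mu := mu)) => // L A mA.
(* [A'] moves the constraints along [f]: injectivity leaves a single one at each [f i], and none is
   imposed off the range. *)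
pose A' j : set T := [set t | forall i, f i = j -> A i t].
have A'f i : A' (f i) = A i.
  by apply/seteqP; split => [t|t Ait k /f_inj->//]; apply.
have mA' j : measurable (A' j).
  have [[i <-]|nf] := pselect (exists i, f i = j); first by rewrite A'f.
  rewrite (_ : A' j = setT) //; apply/seteqP; split => // t _ i fij.
  by case: nf; exists i.
rewrite -[LHS]/(P _) (_ : _ @^-1` _ =
    [set x | forall j, j \in [fset f i | i in L]%fset -> A' j (x j)]).
  rewrite Pmu // big_imfset //=; last by move=> ? ? _ _ /f_inj.
  by apply: eq_bigr => i _; rewrite A'f.
apply/seteqP; split => x /= Ax i.
  by case/imfsetP => k /= kL ->; rewrite A'f; exact: Ax.
by move=> iL; rewrite -A'f; apply: Ax; apply/imfsetP; exists i.
Qed.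

Lemma negligible_coord_map N : measurable N -> Q.-negligible N ->
  P.-negligible (coord_map f @^-1` N).
Proof.
move=> mN nN; apply/negligibleP; last first.
  exact: etrans (product_measure_coord_map mN) (measure_negligible mN nN).
rewrite -[X in measurable X]setTI.
exact: (measurable_coord_map f measurableT mN).
Qed.
End Reindex.

(** * The Borel structure of a second countable topological group *)

Section TopGroup.
Variables (K : topGroupType) (K2 : @second_countable K).
Local Notation BK := (borel K).

Lemma measurable_bigcup_in (I : Type) (D : set I) d (T : measurableType d)
    (F : I -> set T) :
  countable D -> (forall i, D i -> measurable (F i)) ->
  measurable (\bigcup_(i in D) F i).
Proof.
move=> /countable_injP[f f_inj] mF.
rewrite (_ : \bigcup_(i in D) F i =
    \bigcup_n \bigcup_(i in D `&` f @^-1` [set n]) F i).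
  apply: bigcupT_measurable => n.
  have [[i [Di fin]]|nf] := pselect (exists i, D i /\ f i = n).
    rewrite (_ : D `&` _ = [set i]) ?bigcup_set1; first exact: mF.
    apply/seteqP; split => [j [Dj fjn]|j ->//].
    by apply: f_inj; rewrite ?inE // fin; exact: fjn.
  rewrite (_ : D `&` _ = set0) ?bigcup_set0 //.
  by apply/seteqP; split => // i [Di fin]; apply: nf; exists i.
apply/seteqP; split => x.
  by move=> [i Di Fix]; exists (f i) => //; exists i.
by move=> [n _ [i [Di _] Fix]]; exists i.
Qed.

(** The source carries the product of the two Borel sigma-algebras. Second countability makes the
    preimage of an open set a countable union of open rectangles, hence measurable there. *)
Lemma measurable_borel_mul :
  measurable_fun [set: BK * BK] (fun z => z.1 * z.2).
Proof.
case: K2 => B cB [Bo Bb].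
apply: measurability => // _ [U oU <-]; rewrite setTI.
pose D : set (set K * set K) := [set VW | [/\ B VW.1, B VW.2 &
   forall x y, VW.1 x -> VW.2 y -> U (x * y)]].
rewrite (_ : _ @^-1` _ = \bigcup_(VW in D) (VW.1 `*` VW.2)).
  apply: measurable_bigcup_in.
    apply: sub_countable (countableX cB cB).
    by apply: subset_card_le => VW [].
  move=> [V W] [BV BW _]; apply: measurableX; apply: sub_sigma_algebra; exact: Bo.
apply/seteqP; split => [[x y] /= Uxy|[x y] [[V W] [_ _ VWU] [/= Vx Wy]]].
  have : nbhs ((x, y) : K * K) ((fun z : K * K => z.1 * z.2) @^-1` U).
    by apply: mulg_continuous; exact: open_nbhs_nbhs.
  move=> [[V W] /= [nV nW] VWU].
  have [V' [BV' V'x] V'V] := Bb x V nV.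
  have [W' [BW' W'x] W'W] := Bb y W nW.
  exists (V', W') => //; split => //= a b V'a W'b.
  by apply: (VWU (a, b)); split; [exact: V'V|exact: W'W].
exact: VWU.
Qed.

Lemma measurable_borel_inv : measurable_fun [set: BK] (fun x => x^-1).
Proof.
apply: measurability => // _ [U oU <-]; rewrite setTI.
apply: sub_sigma_algebra.
by have /continuousP := @invg_continuous K; apply.
Qed.

Lemma measurable_fun_mulg d (T : measurableType d) (f g : T -> BK) :
  measurable_fun setT f -> measurable_fun setT g ->
  measurable_fun setT (fun t => f t * g t).
Proof.
move=> mf mg.
exact: (measurableT_comp measurable_borel_mul (measurable_fun_pair mf mg)).
Qed.

End TopGroup.

(** * Translation-invariant events over a coset *)

(** Dependence is plain invariance under changes off [S], which suits an argument that moves points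
    rather than sigma-algebras. *)
Definition depends_on (I T : Type) (S : set I) (E : set (prodspace I T)) :=
  forall x y : prodspace I T, (forall i, S i -> x i = y i) -> E x -> E y.

Section Independence.
Variables (R : realType) (G : groupType) (K : topGroupType).
Variables (K2 : @second_countable K) (haar : probability (borel K) R).
Variable P : probability (prodspace G (borel K)) R.
Hypotheses (haarP : is_haar haar) (Phaar : is_product_measure haar P).
Local Notation KG := (prodspace G (borel K)).
Local Open Scope ereal_scope.

Lemma haar_translate (k : borel K) (A : set (borel K)) : measurable A ->
  haar [set y | A (k * y)%g] = haar A.
Proof.
move=> mA; rewrite -[RHS](haarP (k^-1)%g mA); congr (haar _).
apply/seteqP; split => [y Ay|_ [y Ay <-] /=]; last by rewrite mulVKg.
by exists (k * y)%g => //; rewrite mulKg.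
Qed.

Section Twist.
Variables (u : G) (S : set G) (Su : ~ S u).

Let twist (z : KG * KG) : KG :=
  fun h => if `[< S h >] then (z.1 u * z.2 h)%g else z.1 h.

Let measurable_twist : measurable_fun setT twist.
Proof.
apply: measurable_funPi => h; rewrite /twist; case: `[< S h >].
  apply: measurable_fun_mulg => //.
    exact: (measurableT_comp (measurable_proj u) measurable_fst).
  exact: (measurableT_comp (measurable_proj h) measurable_snd).
exact: (measurableT_comp (measurable_proj h) measurable_fst).
Qed.

(* Conditionally on x, the twisted coordinates x u * y h have, by left
   invariance, the same joint law as the y h. *)
Let twist_push (E : set KG) : measurable E ->
  (P \x P) (twist @^-1` E) = P E.
Proof.
pose X : {mfun (KG * KG)%type >-> KG} :=
  HB.pack twist (isMeasurableFun.Build _ _ _ _ _ measurable_twist).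
move=> mE; rewrite -[LHS]/(distribution (P \x P)%E X E).
apply: (product_measure_unique_cyl (mu := haar)) => // J A mA.
rewrite -[LHS]/(product_measure1 P P (twist @^-1` _)) /product_measure1 /=.
(* For fixed x, the constraints indexed by [JC] bear on x alone and those of [JS] on y alone, so
   integrating over y first separates them. *)
pose JS := [fset i in J | `[< S i >]]%fset.
pose JC := [fset i in J | ~~ `[< S i >]]%fset.
pose C := [set x : KG | forall i, i \in JC -> A i (x i)].
transitivity (\int[P]_x ((\prod_(i <- JS) haar (A i)) * (\1_C x)%:E)).
  apply: eq_integral => x _ /=.
  have [Cx|nCx] := pselect (C x).
    rewrite indicE mem_set // mule1.
    pose A' i := [set t | A i (x u * t)%g].
    have mA' i : measurable (A' i).
      have mx : measurable_fun setT (fun t : borel K => (x u : borel K) * t)%g.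
        by apply: measurable_fun_mulg.
      by rewrite -[A' i]setTI; exact: mx.
    rewrite -(eq_bigr _ (fun i _ => haar_translate (x u) (mA i))).
    rewrite -[RHS](Phaar JS mA'); congr (P _).
    apply/seteqP; split => y; rewrite /xsection /= inE /= => Ay i.
      rewrite !inE => /andP[iJ Si].
      by have := Ay _ iJ; rewrite /twist Si.
    move=> iJ; rewrite /twist; case: ifP => Si.
      by apply: Ay; rewrite !inE iJ Si.
    by apply: Cx; rewrite !inE iJ Si.
  rewrite indicE memNset // mule0.
  rewrite (_ : xsection _ _ = set0) ?measure0 //.
  apply/seteqP; split => // y; rewrite /xsection /= inE /= => Ay; apply: nCx => i.
  rewrite !inE => /andP[iJ /negPf Si].
  by have := Ay _ iJ; rewrite /twist Si.
have mC : measurable C by exact: measurable_cylinder.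
rewrite ge0_integralZl //.
- rewrite integral_indic // setIT; apply: etrans (congr1 (mule _) (Phaar JC mA)) _.
  by rewrite [RHS](big_fsetID _ (fun i => `[< S i >])).
- by apply/measurable_EFinP; exact: measurable_indic.
- by apply: prode_ge0 => i _; exact: measure_ge0.
Qed.

(** [twist] carries [P \x P] to [P]. Through it [E'] sees only the first sample and [E], after
    division by the coordinate at [u], only the second; the two samples are independent. *)
Lemma indep_twist (E E' : set KG) : measurable E -> measurable E' ->
  (forall (k : K) x, E x -> E (diag_act k x)) -> depends_on (S `|` [set u]) E ->
  depends_on (~` S) E' -> P (E `&` E') = P E * P E'.
Proof.
move=> mE mE' Ek Ed Ed'.
(* Dividing the twisted point by [z.1 u] leaves [z.2] on [S] and 1 at [u], whence the value 1 put
   there. *)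
pose one_at (y : KG) : KG := fun h => if h == u then 1%g else y h.
have m1 : measurable_fun setT one_at.
  apply: measurable_funPi => h; rewrite /one_at; case: (h == u) => //.
  exact: measurable_proj.
pose E1 := one_at @^-1` E.
have mE1 : measurable E1 by rewrite -[E1]setTI; exact: m1.
have twE z : E (twist z) <-> E1 z.2.
  split=> Ez.
    apply: Ed (Ek (z.1 u)^-1%g _ Ez) => h [Sh|->].
      rewrite /diag_act /twist asboolT // mulKg /one_at ifF //.
      by apply/eqP => hu; apply: Su; rewrite -hu.
    by rewrite /diag_act /twist asboolF // mulVg /one_at eqxx.
  apply: Ed (Ek (z.1 u) _ Ez) => h [Sh|->].
    rewrite /diag_act /twist asboolT // /one_at ifF //.
    by apply/eqP => hu; apply: Su; rewrite -hu.
  by rewrite /diag_act /twist asboolF // /one_at eqxx mulg1.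
have twE' z : E' (twist z) <-> E' z.1.
  by split; apply: Ed' => h nSh; rewrite /twist asboolF.
(* Used for [E'] and for the whole space; the latter identifies [P E1] with [P E]. *)
have PE F : measurable F -> (forall z, F (twist z) <-> F z.1) ->
    P (E `&` F) = P F * P E1.
  move=> mF twF; rewrite -twist_push; last exact: measurableI.
  rewrite (_ : twist @^-1` _ = F `*` E1) ?product_measure1E //.
  by apply/seteqP; split => z /= [] => [/twE ? /twF|/twF ? /twE].
rewrite (PE _ mE' twE') -[in P E](setIT E) (PE setT) //.
by rewrite probability_setT mul1e muleC.
Qed.
End Twist.
End Independence.

(** * Isomorphisms with a Bernoulli action as codings *)

(** The equivariant map whose coordinate at 1 is [F]. Each equivariant map to [prodspace G U] has
    this form, its coordinate at h being the one at 1 after translation by h. *)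
Definition factor_map (G : groupType) (T U : Type) (F : prodspace G T -> U)
  (x : prodspace G T) : prodspace G U := fun h => F (bernoulli h x).

Lemma factor_map_bernoulli (G : groupType) (T U : Type)
    (F : prodspace G T -> U) g x :
  factor_map F (bernoulli g x) = bernoulli g (factor_map F x).
Proof. by apply/funext => h; rewrite /factor_map -bernoulliM. Qed.

Lemma measurable_bernoulli (G : groupType) d (T : measurableType d) (g : G) :
  measurable_fun setT (bernoulli g : prodspace G T -> prodspace G T).
Proof. exact: (measurable_coord_map (fun h : G => h * g)). Qed.

Lemma measurable_factor_map (G : groupType) d (T : measurableType d) d'
    (U : measurableType d') (F : prodspace G T -> U) :
  measurable_fun setT F -> measurable_fun setT (factor_map F).
Proof.
move=> mF; apply: measurable_funPi => h.
exact: (measurableT_comp mF (measurable_bernoulli h)).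
Qed.

(** The point of the K-orbit with value 1 at 1. It yields a measurable section of the quotient map,
    whereas [repr] is an arbitrary choice. *)
Definition normalize (G : groupType) (K : topGroupType)
  (x : prodspace G (borel K)) : prodspace G (borel K) := diag_act (x 1)^-1 x.

Lemma diag_act_bernoulli (G : groupType) (K : topGroupType) (k : K) (g : G)
    (x : prodspace G (borel K)) :
  bernoulli g (diag_act k x) = diag_act k (bernoulli g x).
Proof. by []. Qed.

Lemma diag_actK (G : groupType) (K : topGroupType) (k : K)
    (x : prodspace G (borel K)) : diag_act k^-1 (diag_act k x) = x.
Proof. by apply/funext => h; rewrite /diag_act mulKg. Qed.

Lemma normalize_diag_act (G : groupType) (K : topGroupType) (k : K)
    (x : prodspace G (borel K)) : normalize (diag_act k x) = normalize x.
Proof.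
by apply/funext => h; rewrite /normalize /diag_act invgM -mulgA mulKg.
Qed.

Lemma diag_pi_normalize (G : groupType) (K : topGroupType)
    (x : prodspace G (borel K)) : diag_pi (normalize x) = diag_pi x.
Proof. by apply/esym/diag_piP; exists (x 1)^-1. Qed.

Lemma measurable_normalize (G : groupType) (K : topGroupType) :
  @second_countable K ->
  measurable_fun setT (@normalize G K).
Proof.
move=> K2; apply: measurable_funPi => h; apply: measurable_fun_mulg => //.
  apply: (measurableT_comp (@measurable_borel_inv K)); exact: measurable_proj.
exact: measurable_proj.
Qed.

(* A description, upstairs on K^G, of an isomorphism between K^G / K and the
   Bernoulli action with base Y: F is the coordinate at 1 of the isomorphism, s
   its inverse followed by the normalization x 1 = 1, and A and B are the
   conegligible sets between which factor_map F induces a bijection. *)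
Record coding (R : realType) (G : groupType) (K : topGroupType) d
    (Y : measurableType d) (P : probability (prodspace G (borel K)) R)
    (Q : probability (prodspace G Y) R) (F : prodspace G (borel K) -> Y)
    (s : prodspace G Y -> prodspace G (borel K))
    (A : set (prodspace G (borel K))) (B : set (prodspace G Y)) : Prop := Coding {
  coding_mF : measurable_fun setT F;
  coding_ms : measurable_fun setT s;
  coding_mA : measurable A;
  coding_mB : measurable B;
  coding_A : P.-negligible (~` A);
  coding_F_diag : forall k x, F (diag_act k x) = F x;
  coding_A_diag : forall k x, A x -> A (diag_act k x);
  coding_A_shift : forall g x, A x -> A (bernoulli g x);
  coding_AB : forall x, A x -> B (factor_map F x);
  coding_BA : forall w, B w -> A (s w);
  coding_FK : forall x, A x -> s (factor_map F x) = normalize x;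
  coding_sK : forall w, B w -> factor_map F (s w) = w;
  coding_s1 : forall w, s w 1 = 1;
  coding_push : forall C, measurable C -> P (factor_map F @^-1` C) = Q C
}.

Section Coding.
Variables (R : realType) (G : groupType) (K : topGroupType).
Variables (d : measure_display) (Y : measurableType d).
Variables (P : probability (prodspace G (borel K)) R).
Variables (Q : probability (prodspace G Y) R).
Local Notation KG := (prodspace G (borel K)).
Local Notation YG := (prodspace G Y).
Local Notation quot := (diag_quot G K).

Lemma measurable_quotP (B : set quot) :
  measurable B <-> measurable (@diag_pi G K @^-1` B).
Proof.
by rewrite -[measurable B]/(measurable (setT `&` @diag_pi G K @^-1` B)) setTI.
Qed.

Lemma repr_diag_pi (x : KG) : exists k : K, repr (diag_pi x) = diag_act k x.
Proof.
have /diag_piP[k ->] : diag_pi x = diag_pi (repr (diag_pi x)).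
  apply/esym; exact: reprK.
by exists k.
Qed.

(** By [coding_F_diag] the factor map descends to [D] on the quotient, and [diag_pi \o s] inverts it
    between [A0] and [B]. *)
Lemma coding_isomorphic F s A B : coding P Q F s A B ->
  isomorphic_actions (quot_prob P) (@quot_act G K) Q (@bernoulli G Y).
Proof.
move=> c; pose D (q : quot) : YG := factor_map F (repr q).
have factorK k (x : KG) : factor_map F (diag_act k x) = factor_map F x.
  by apply/funext => h; rewrite /factor_map diag_act_bernoulli (coding_F_diag c).
have Dpi (x : KG) : D (diag_pi x) = factor_map F x.
  by rewrite /D; have [k ->] := repr_diag_pi x.
have mfac := measurable_factor_map (coding_mF c).
have mfacC C : measurable C -> measurable (factor_map F @^-1` C).
  by move=> mC; rewrite -[X in measurable X]setTI; exact: mfac.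
have mD : measurable_fun setT D.
  move=> _ C mC; rewrite setTI; apply/measurable_quotP.
  rewrite (_ : _ @^-1` _ = factor_map F @^-1` C); first exact: mfacC.
  by apply/funext => x; rewrite /preimage /= Dpi.
pose A0 : set quot := [set q | A (repr q)].
have piA0 : @diag_pi G K @^-1` A0 = A.
  apply/seteqP; split => x; rewrite /A0 /=; have [k ->] := repr_diag_pi x => Ax.
    by rewrite -(diag_actK k x); exact: (coding_A_diag c).
  exact: (coding_A_diag c).
have A0pi x : A0 (diag_pi x) <-> A x by rewrite -[in A x]piA0.
have mA0 : measurable A0 by apply/measurable_quotP; rewrite piA0; exact: coding_mA c.
have PA : P (~` A) = 0%E.
  by apply/negligibleP; [exact: measurableC (coding_mA c)|exact: coding_A c].
pose E (w : YG) : quot := diag_pi (s w).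
have mE : measurable_fun setT E.
  exact: (measurableT_comp (@measurable_diag_pi G K) (coding_ms c)).
have DK q : A0 q -> E (D q) = q.
  move=> A0q; rewrite /E /D (coding_FK c) // diag_pi_normalize; exact: reprK.
have EK w : B w -> D (E w) = w by move=> Bw; rewrite /E Dpi (coding_sK c).
have EA w : B w -> A0 (E w) by move=> Bw; apply/A0pi; exact: (coding_BA c).
have DB q : A0 q -> B (D q) by move=> A0q; exact: (coding_AB c).
have DI C : measurable C -> quot_prob P (A0 `&` D @^-1` C) = Q C.
  move=> mC; rewrite -(coding_push c mC).
  rewrite -[LHS]/(P (@diag_pi G K @^-1` (A0 `&` D @^-1` C))).
  rewrite (_ : @diag_pi G K @^-1` _ = A `&` factor_map F @^-1` C).
    exact: (measure_setI_conull (coding_mA c) (mfacC _ mC) (coding_A c)).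
  by apply/seteqP; split => x /= [] /=; rewrite /preimage /= Dpi => /A0pi.
exists D; split; last first.
  move=> g; apply: aeW => q; rewrite /quot_act Dpi factor_map_bernoulli //.
exists A0, B; split=> //.
- split; split=> //.
  + by rewrite -[LHS]/(P (~` (@diag_pi G K @^-1` A0))) piA0.
  + exact: coding_mB c.
  + rewrite -(coding_push c); last exact: measurableC (coding_mB c).
    apply: measure_negligible.
      by apply: mfacC; apply: measurableC; exact: coding_mB c.
    by apply: negligibleS (coding_A c) => x nBx Ax; apply: nBx; exact: (coding_AB c).
- split=> [q A0q|q q' |w Bw]; first exact: DB.
    by rewrite !inE => A0q A0q' Dqq'; rewrite -(DK q) // Dqq' DK.
  by exists (E w); [exact: EA|exact: EK].
- exact: measurable_funS mD.
(* The image under [D] is a preimage under the inverse [E], cut down to [B], hence measurable. *)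
- move=> C CA mC; rewrite (_ : D @` C = B `&` E @^-1` C).
    apply: measurableI; first exact: coding_mB c.
    by rewrite -[X in measurable X]setTI; exact: mE.
  apply/seteqP; split => [_ [q Cq <-]|w [Bw CEw]].
    by split; [apply/DB/CA|rewrite /preimage /= DK //; exact: CA].
  by exists (E w) => //; exact: EK.
Qed.
End Coding.

Lemma measurable_set_cst d (T : measurableType d) (p : Prop) :
  measurable [set _ : T | p].
Proof.
have [pT|pF] := pselect p.
  by rewrite (_ : [set _ | p] = setT) //; apply/seteqP; split.
by rewrite (_ : [set _ | p] = set0) //; apply/seteqP; split.
Qed.

Lemma measurable_fun_patch d d' (T : measurableType d) (U : measurableType d')
    (A : set T) (f : T -> U) (u : U) : measurable A -> measurable_fun A f ->
  measurable_fun setT (fun t => if pselect (A t) then f t else u).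
Proof.
move=> mA mf _ C mC; rewrite setTI.
rewrite (_ : _ @^-1` _ = (A `&` f @^-1` C) `|` (~` A `&` [set _ | C u])).
  apply: measurableU; first exact: mf.
  by apply: measurableI; [exact: measurableC|exact: measurable_set_cst].
apply/seteqP; split => t; rewrite /preimage /=; case: pselect => At /=.
- by left.
- by right.
- by case=> -[].
- by case=> -[].
Qed.

Lemma diag_pi_diag_act (G : groupType) (K : topGroupType) (k : K)
    (x : prodspace G (borel K)) : diag_pi (diag_act k x) = diag_pi x.
Proof. by apply/esym/diag_piP; exists k. Qed.

(** * From an isomorphism to a coding *)

Section IsoCoding.
Variables (R : realType) (G : groupType) (K : topGroupType).
Variables (d : measure_display) (Y : measurableType d).
Variables (haar : probability (borel K) R).
Variables (P : probability (prodspace G (borel K)) R).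
Variables (Q : probability (prodspace G Y) R).
Local Notation KG := (prodspace G (borel K)).
Local Notation YG := (prodspace G Y).
Local Notation quot := (diag_quot G K).

(** The given isomorphism is equivariant only almost everywhere and meaningful only on [A0]. As G is
    countable, discarding all translates of the exceptional sets leaves a conegligible invariant set
    on which equivariance is exact. *)
Lemma isomorphic_coding : countable [set: G] -> @second_countable K ->
  is_product_measure haar P ->
  isomorphic_actions (quot_prob P) (@quot_act G K) Q (@bernoulli G Y) ->
  exists F s A B, coding P Q F s A B.
Proof.
move=> cG K2 Phaar [D [[A0 [A1 [[[mA0 PA0] _] bijD mD mDI PD]]] aeD]].
have {aeD} /choice[N NP] : forall g, exists N : set quot, [/\ measurable N,
    quot_prob P N = 0%E &
    forall q, ~ N q -> D (quot_act g q) = bernoulli g (D q)].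
  move=> g; have [N [mN PN DN]] := aeD g; exists N; split => // q nNq.
  by apply: contrapT => Dq; apply: nNq; exact: DN.
have mpi (C : set quot) : measurable C -> measurable (@diag_pi G K @^-1` C).
  by move=> /measurable_quotP.
pose bad h : set KG := @diag_pi G K @^-1` (~` A0 `|` N h).
have mbad h : measurable (bad h).
  by apply: mpi; apply: measurableU; [exact: measurableC|case: (NP h)].
have Pbad h : P (bad h) = 0%E.
  have [mN PN _] := NP h.
  rewrite -[LHS]/(quot_prob P (~` A0 `|` N h)) measureU0 //.
  exact: measurableC.
pose A : set KG := [set x | forall g h, ~ bad h (bernoulli g x)].
have mA : measurable A.
  apply: measurable_forall => // g; apply: measurable_forall => // h.
  rewrite -[X in measurable X]setTI.
  exact: (@measurable_bernoulli _ _ _ g measurableT _ (measurableC (mbad h))).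
have nA : P.-negligible (~` A).
  have nbad g h : P.-negligible (bernoulli g @^-1` bad h).
    have nh : P.-negligible (bad h) by apply/negligibleP; [exact: mbad|exact: Pbad].
    exact: (negligible_coord_map (mulIg g) Phaar Phaar (mbad h) nh).
  have := negligible_exists cG (fun g => negligible_exists cG (nbad g)).
  apply: negligibleS => x nAx.
  by apply: contrapT => nex; apply: nAx => g h bx; apply: nex; exists g, h.
have A_shift g x : A x -> A (bernoulli g x).
  by move=> Ax a b; rewrite -bernoulliM; exact: Ax.
have bad_diag h k x : bad h (diag_act k x) = bad h x.
  by rewrite /bad /preimage /= diag_pi_diag_act.
have A_diag k x : A x -> A (diag_act k x).
  by move=> Ax g h; rewrite diag_act_bernoulli bad_diag; exact: Ax.
have A_A0 x : A x -> A0 (diag_pi x).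
  move=> Ax; apply: contrapT => nA0; apply: (Ax 1 1).
  by rewrite bernoulli1; left.
(* Off [A0] the map [D] is junk, so a constant replaces it to make [F] measurable everywhere. *)
pose F (x : KG) : Y :=
  (if pselect (A0 (diag_pi x)) then D (diag_pi x) else point) 1.
have FE x : A x -> factor_map F x = D (diag_pi x).
  move=> Ax; apply/funext => h; rewrite /factor_map /F.
  case: pselect => [A0h|[]]; last by apply: A_A0; exact: A_shift.
  have [_ _ DN] := NP h; rewrite /= -quot_actE DN ?/bernoulli ?mul1g //.
  by move=> Nh; apply: (Ax 1 h); rewrite bernoulli1; right.
pose Aq : set quot := [set q | A (repr q)].
have Aqpi x : Aq (diag_pi x) <-> A x.
  rewrite /Aq /=; have [k ->] := repr_diag_pi x; split; last exact: A_diag.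
  by move=> Ax; rewrite -(diag_actK k x); exact: A_diag.
have mAq : measurable Aq.
  apply/measurable_quotP; rewrite (_ : _ @^-1` _ = A) //.
  by apply/seteqP; split => x /Aqpi.
have AqA0 : Aq `<=` A0.
  by move=> q; rewrite -[q](@reprK _ _) => /Aqpi /A_A0.
pose B : set YG := D @` Aq.
have mB : measurable B by exact: mDI.
(* Off [B] the constant 1 keeps both measurability and the value 1 at 1. *)
pose s (w : YG) : KG :=
  if pselect (B w) is left Bw then normalize (repr (s2val (cid2 Bw))) else fun=> 1.
have sD q : Aq q -> s (D q) = normalize (repr q).
  move=> Aqq; rewrite /s; case: pselect => [Bw|[]]; last by exists q.
  case: cid2 => q' /= Aqq' Dqq'; congr (normalize (repr _)).
  have [_ injD _] := bijD.
  by apply: injD => //; rewrite inE; exact: AqA0.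
have sK q : Aq q -> diag_pi (s (D q)) = q.
  by move=> Aqq; rewrite sD // diag_pi_normalize; exact: reprK.
have ms : measurable_fun setT s.
  move=> _ C mC; rewrite setTI.
  (* Normalization forgets the representative, so [Cq] is measurable in spite of [repr]. Its part in
     [Aq] has a measurable image under [D], the inverse of [D] being Borel. *)
  pose Cq : set quot := [set q | C (normalize (repr q))].
  have mCq : measurable Cq.
    apply/measurable_quotP; rewrite (_ : _ @^-1` _ = @normalize G K @^-1` C).
      by rewrite -[X in measurable X]setTI; exact: measurable_normalize.
    apply/funext => x; rewrite /Cq /preimage /=.
    by have [k ->] := repr_diag_pi x; rewrite normalize_diag_act.
  rewrite (_ : s @^-1` C = D @` (Aq `&` Cq) `|` (~` B `&` [set _ | C (fun=> 1)])).
    apply: measurableU.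
      by apply: mDI; [move=> q [/AqA0]|exact: measurableI].
    apply: measurableI; first exact: measurableC.
    exact: measurable_set_cst.
  apply/seteqP; split => [w sw|w [[q [Aqq Cqq] <-]|[nBw C1]]].
  - have [Bw|nBw] := pselect (B w).
      by left; case: Bw sw => q Aqq <-; rewrite /preimage /= sD // => Cq'; exists q.
    by right; split => //; move: sw; rewrite /preimage /s /=; case: pselect.
  - by rewrite /preimage /= sD.
  - by rewrite /preimage /= /s; case: pselect.
have mF : measurable_fun setT F.
  pose D0 q : YG := if pselect (A0 q) then D q else point.
  have mD0 : measurable_fun setT D0 by exact: measurable_fun_patch.
  exact: (measurableT_comp (measurable_proj 1)
    (measurableT_comp mD0 (@measurable_diag_pi G K))).
exists F, s, A, B; split => //.
- by move=> k x; rewrite /F diag_pi_diag_act.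
- by move=> x Ax; rewrite FE //; exists (diag_pi x) => //; exact/Aqpi.
- by move=> _ [q Aqq <-]; apply/Aqpi; rewrite sK.
- move=> x Ax; rewrite FE // sD; last exact/Aqpi.
  by have [k ->] := repr_diag_pi x; exact: normalize_diag_act.
- by move=> _ [q Aqq <-]; rewrite FE ?sK //; apply/Aqpi; rewrite sK.
- move=> w; rewrite /s; case: pselect => // Bw.
  by rewrite /normalize /diag_act mulVg.
move=> C mC; rewrite -(PD _ mC).
have mC' : measurable (A0 `&` D @^-1` C) by exact: mD.
rewrite -[RHS]/(P (@diag_pi G K @^-1` (A0 `&` D @^-1` C))).
(* Both events are compared on the conegligible set [A], where the factor map is given by [D]. *)
rewrite -[RHS](measure_setI_conull mA (mpi _ mC') nA).
have mF' : measurable (factor_map F @^-1` C).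
  rewrite -[X in measurable X]setTI; exact: (measurable_factor_map mF measurableT mC).
rewrite -[LHS](measure_setI_conull mA mF' nA); congr (P _).
apply/seteqP; split => x [Ax]; rewrite /preimage /= FE //.
  by move=> CD; split => //; split => //; exact: A_A0.
by case.
Qed.
End IsoCoding.

(** * Cosets of the factors of a free product *)

Section FreeProductCosets.
Variables G0 G1 : groupType.
Local Notation FG := (freeprod G0 G1).
Implicit Types (g u : FG) (w : seq (G0 + G1)).

Lemma fpinl_mulE h g : fpword (fpinl G1 h * g) = lmul (inl h) g.
Proof. exact: (@wmul_lmul _ _ (inl h) [::] g isT (fpwordP g)). Qed.

Lemma fpinr_mulE h g : fpword (fpinr G0 h * g) = lmul (inr h) g.
Proof. exact: (@wmul_lmul _ _ (inr h) [::] g isT (fpwordP g)). Qed.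

Definition headl g : G0 := if fpword g is inl h :: _ then h else 1.
Definition headr g : G1 := if fpword g is inr h :: _ then h else 1.

(* The shortest element of the right coset of the factor G0 (resp. G1). *)
Definition minl g : FG := fpinl G1 (headl g)^-1 * g.
Definition minr g : FG := fpinr G0 (headr g)^-1 * g.

Lemma fpinl1 : fpinl G1 (1 : G0) = 1.
Proof. by apply: val_inj; rewrite /= eqxx. Qed.

Lemma fpinr1 : fpinr G0 (1 : G1) = 1.
Proof. by apply: val_inj; rewrite /= eqxx. Qed.

Lemma fpinlV (h : G0) : fpinl G1 h^-1 = (fpinl G1 h)^-1.
Proof. by apply: (mulgI (fpinl G1 h)); rewrite -fpinlM !mulgV fpinl1. Qed.

Lemma fpinrV (h : G1) : fpinr G0 h^-1 = (fpinr G0 h)^-1.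
Proof. by apply: (mulgI (fpinr G0 h)); rewrite -fpinrM !mulgV fpinr1. Qed.

Lemma minl_decomp g : g = fpinl G1 (headl g) * minl g.
Proof. by rewrite /minl fpinlV mulVKg. Qed.

Lemma minr_decomp g : g = fpinr G0 (headr g) * minr g.
Proof. by rewrite /minr fpinrV mulVKg. Qed.

(** The pair of [b] and this element names a coset, [false] standing for [G0], so that the cosets of
    both factors can be sorted in one list. *)
Definition coset_rep (b : bool) g := if b then minr g else minl g.

Lemma fpword_minl g : fpword (minl g) =
  if fpword g is inl _ :: w then w else fpword g.
Proof.
rewrite /minl fpinl_mulE /headl; case: (fpword g) => [|[h|h] w] /=.
- by rewrite invg1 eqxx.
- by rewrite mulVg eqxx.
- by rewrite invg1 eqxx.
Qed.

Lemma fpword_minr g : fpword (minr g) =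
  if fpword g is inr _ :: w then w else fpword g.
Proof.
rewrite /minr fpinr_mulE /headr; case: (fpword g) => [|[h|h] w] /=.
- by rewrite invg1 eqxx.
- by rewrite invg1 eqxx.
- by rewrite mulVg eqxx.
Qed.

Lemma headl_minl g : headl (minl g) = 1.
Proof.
rewrite /headl fpword_minl.
have := fpwordP g; case: (fpword g) => [|[h|h] [|[k|k] w]] //=.
by rewrite /reduced /= andbF.
Qed.

Lemma headr_minr g : headr (minr g) = 1.
Proof.
rewrite /headr fpword_minr.
have := fpwordP g; case: (fpword g) => [|[h|h] [|[k|k] w]] //=.
by rewrite /reduced /= andbF.
Qed.

Lemma headl_mul h u : headl u = 1 -> headl (fpinl G1 h * u) = h.
Proof.
rewrite /headl fpinl_mulE; have := fpwordP u.
case: (fpword u) => [|[k|k] w] /=.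
- by case: eqP => [->|].
- by rewrite /reduced /= => /andP[/andP[/eqP k1 _] _] /k1.
- by case: eqP => [->|].
Qed.

Lemma headr_mul h u : headr u = 1 -> headr (fpinr G0 h * u) = h.
Proof.
rewrite /headr fpinr_mulE; have := fpwordP u.
case: (fpword u) => [|[k|k] w] /=.
- by case: eqP => [->|].
- by case: eqP => [->|].
- by rewrite /reduced /= => /andP[/andP[/eqP k1 _] _] /k1.
Qed.

Lemma minl_mul h g : minl (fpinl G1 h * g) = minl g.
Proof.
rewrite [in LHS](minl_decomp g) mulgA -fpinlM /minl.
by rewrite headl_mul ?headl_minl // fpinlV mulKg.
Qed.

Lemma minr_mul h g : minr (fpinr G0 h * g) = minr g.
Proof.
rewrite [in LHS](minr_decomp g) mulgA -fpinrM /minr.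
by rewrite headr_mul ?headr_minr // fpinrV mulKg.
Qed.

Lemma fpinl_inj : injective (@fpinl G0 G1).
Proof.
move=> h k hk; have h1 : headl (1 : FG) = 1 by [].
by rewrite -(headl_mul h h1) hk headl_mul.
Qed.

Lemma fpinr_inj : injective (@fpinr G0 G1).
Proof.
move=> h k hk; have h1 : headr (1 : FG) = 1 by [].
by rewrite -(headr_mul h h1) hk headr_mul.
Qed.

(** The word of g has at most one first letter, so only the factor owning it can shorten g. *)
Lemma coset_rep_size b g : coset_rep b g <> g ->
  (size (coset_rep b g) < size g)%N /\ coset_rep (~~ b) g = g.
Proof.
move=> bg; suff: (size (coset_rep b g) < size g)%N /\
    fpword (coset_rep (~~ b) g) = g by case=> ? /val_inj.
have {bg} : fpword (coset_rep b g) <> g by move=> /val_inj.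
have [rF rT] : coset_rep false g = minl g /\ coset_rep true g = minr g by [].
case: b; rewrite [~~ _]/= rF rT fpword_minl fpword_minr.
  by case: (fpword g) => [|[]].
by case: (fpword g) => [|[]].
Qed.

(** Were g not shortest in its [b]-coset, it would be shortest in the other one, which would then
    have the strictly longer representative. *)
Lemma coset_rep_inter b b' g : (b, coset_rep b g) != (b', coset_rep b' g) ->
  (size (coset_rep b' g) <= size (coset_rep b g))%N -> coset_rep b g = g.
Proof.
move=> bb' sz; apply: contrapT => /coset_rep_size[lt_g bg].
have Eb : b' = ~~ b by move: bb'; case: (b); case: (b') => //; rewrite eqxx.
by move: sz; rewrite Eb bg leqNgt lt_g.
Qed.

Lemma countable_freeprod :
  countable [set: G0] -> countable [set: G1] -> countable [set: FG].
Proof.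
move=> /countable_injP[f0 f0_inj] /countable_injP[f1 f1_inj].
pose f (l : G0 + G1) : nat + nat :=
  match l with inl h => inl (f0 h) | inr h => inr (f1 h) end.
have f_inj : injective f.
  move=> [h|h] [k|k] //= [hk]; congr (_ _).
    by apply: f0_inj; rewrite ?inE.
  by apply: f1_inj; rewrite ?inE.
apply/countable_injP; exists (fun g : FG => choice.pickle (map f (fpword g))).
move=> g g' _ _ /(pcan_inj choice.pickleK) /(inj_map f_inj); exact: val_inj.
Qed.
End FreeProductCosets.

(** * Independence of events carried by distinct cosets *)

Section CosetIndependence.
Variables (R : realType) (G0 G1 : groupType) (K : topGroupType).
Local Notation FG := (freeprod G0 G1).
Variables (K2 : @second_countable K) (haar : probability (borel K) R).
Variable P : probability (prodspace FG (borel K)) R.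
Hypotheses (haarP : is_haar haar) (Phaar : is_product_measure haar P).
Variable E : bool * FG -> set (prodspace FG (borel K)).
Hypotheses (mE : forall v, measurable (E v))
  (E_diag : forall v k x, E v x -> E v (diag_act k x))
  (E_dep : forall v, depends_on [set g | coset_rep v.1 g = v.2] (E v)).

Definition rep_geq (v w : bool * FG) : bool := (size w.2 <= size v.2)%N.

(* The coset with the longest representative u is peeled off first: the other
   cosets of the list meet it at most in u. *)
Lemma indep_cosets_sorted (vs : seq (bool * FG)) : uniq vs ->
  sorted rep_geq vs ->
  P [set x | forall v, v \in vs -> E v x] = (\prod_(v <- vs) P (E v))%E.
Proof.
elim: vs => [|v vs IH] /=.
  move=> _ _; rewrite big_nil -(probability_setT P); congr (P _).
  by apply/seteqP; split.
move=> /andP[v_vs uvs] p_vs; rewrite big_cons -IH ?(path_sorted p_vs) //.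
have trans : transitive rep_geq.
  by move=> a b c ab ca; exact: leq_trans ca ab.
have sz := order_path_min trans p_vs.
(* The representative is left out of [S]: it is the point [u] of [indep_twist], which later cosets
   may share. *)
pose S : set FG := [set g | coset_rep v.1 g = v.2 /\ g <> v.2].
rewrite -(@indep_twist R FG K K2 haar P haarP Phaar v.2 S) //.
- congr (P _); apply/seteqP; split => x.
    move=> Ex; split; first by apply: Ex; rewrite inE eqxx.
    by move=> w wvs; apply: Ex; rewrite inE wvs orbT.
  by case=> Ev Evs w; rewrite inE => /predU1P[->//|]; exact: Evs.
- by case.
- rewrite (_ : [set x | _] = \bigcap_(w in [set` vs]) E w) //.
  by apply: fin_bigcap_measurable.
- by move=> *; exact: E_diag.
- move=> x y xy; apply: E_dep => g vg; apply: xy.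
  by have [->|gv] := pselect (g = v.2); [right|left].
(* The representative of a later coset is at most as long, so [coset_rep_inter] keeps that coset off
   [S]. *)
- move=> x y xy Ex w wvs; apply: E_dep (Ex w wvs) => g wg; apply: xy => -[vg gv].
  apply: gv; rewrite -vg; apply/esym; apply: (@coset_rep_inter _ _ _ w.1).
    rewrite vg wg -!surjective_pairing.
    by apply: contra v_vs => /eqP->.
  by rewrite vg wg; move/allP: sz; apply.
Qed.

Lemma indep_cosets (vs : seq (bool * FG)) : uniq vs ->
  P [set x | forall v, v \in vs -> E v x] = (\prod_(v <- vs) P (E v))%E.
Proof.
move=> uvs.
rewrite -(perm_big _ (permEl (perm_sort rep_geq vs))) /=.
rewrite -indep_cosets_sorted ?sort_uniq //; last first.
  by apply: sort_sorted => v w; exact: leq_total.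
by congr (P _); apply/seteqP; split => x Ex v; have := Ex v; rewrite mem_sort.
Qed.
End CosetIndependence.

(** * Label events on the cosets of one factor *)

Section CosetEvents.
Variables (R : realType) (G H : groupType) (K : topGroupType).
Variables (d : measure_display) (Y : measurableType d).
Variables (iota : H -> G) (rep : G -> G) (head : G -> H).
Hypotheses (iotaM : {morph iota : h k / h * k}) (iota_inj : injective iota)
  (decomp : forall g, g = iota (head g) * rep g)
  (rep_mul : forall h g, rep (iota h * g) = rep g).
Variables (haar : probability (borel K) R) (mu : probability Y R).
Variables (P : probability (prodspace G (borel K)) R).
Variables (PH : probability (prodspace H (borel K)) R).
Variables (QH : probability (prodspace H Y) R).
Hypotheses (Phaar : is_product_measure haar P)
  (PHhaar : is_product_measure haar PH) (QHmu : is_product_measure mu QH).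
Variable F : prodspace H (borel K) -> Y.
Hypotheses (mF : measurable_fun setT F)
  (F_diag : forall k x, F (diag_act k x) = F x)
  (F_push : forall C, measurable C -> PH (factor_map F @^-1` C) = QH C).
Variables (J : {fset G}) (B : G -> set Y).
Hypothesis (mB : forall j, measurable (B j)).
Local Notation KG := (prodspace G (borel K)).

Lemma coord_map_bernoulli (T : Type) (h : H) (g : G) (x : prodspace G T) :
  coord_map iota (bernoulli (iota h * g) x) =
  bernoulli h (coord_map iota (bernoulli g x)).
Proof.
by apply/funext => k; rewrite /coord_map /bernoulli iotaM mulgA.
Qed.

(** The part of a cylinder condition on labels that bears on the coset of [u]. The maps [iota],
    [rep] and [head] stand for either factor, so one argument serves both. *)
Definition coset_event (u : G) : set KG := [set x | forall j, j \in J ->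
  rep j = u -> B j (F (coord_map iota (bernoulli j x)))].

Lemma measurable_coset_event u : measurable (coset_event u).
Proof.
rewrite (_ : coset_event u = \bigcap_(j in [set` [fset j in J | rep j == u]%fset])
   ((fun x : KG => F (coord_map iota (bernoulli j x))) @^-1` B j)).
  apply: fin_bigcap_measurable; first exact: finite_fset.
  move=> j _; rewrite -[X in measurable X]setTI.
  have m := measurableT_comp mF (measurableT_comp (measurable_coord_map iota)
    (measurable_bernoulli j)).
  exact: m.
apply/seteqP; split => x Ex j /=; first by rewrite !inE => /andP[jJ /eqP ju]; exact: Ex.
by move=> jJ ju; apply: Ex; rewrite /= !inE jJ ju eqxx.
Qed.

Lemma coset_event_diag u k x : coset_event u x -> coset_event u (diag_act k x).
Proof.
move=> Ex j jJ ju; rewrite -[coord_map _ _]/(diag_act k (coord_map iota (bernoulli j x))).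
by rewrite F_diag; exact: Ex.
Qed.

Lemma coset_event_dep u : depends_on [set g | rep g = u] (coset_event u).
Proof.
move=> x y xy Ex j jJ ju.
rewrite (_ : coord_map _ _ = coord_map iota (bernoulli j x)); first exact: Ex.
by apply/funext => h; rewrite /coord_map /bernoulli -xy //= rep_mul.
Qed.

(** Sending h to [iota h * u] identifies H with the coset of [u]. Pulled back along it, the labels
    on the coset are given by [factor_map F], whose law [QH] is a product measure. *)
Lemma coset_event_prob u :
  P (coset_event u) = (\prod_(j <- J | rep j == u) mu (B j))%E.
Proof.
pose Ju := [fset j in J | rep j == u]%fset.
have headK j : j \in Ju -> iota (head j) * u = j.
  by rewrite !inE => /andP[_ /eqP <-]; rewrite -decomp.
pose J' := [fset head j | j in Ju]%fset.
pose C : set (prodspace H Y) := [set y | forall h, h \in J' -> B (iota h * u) (y h)].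
have mC : measurable C by exact: (measurable_cylinder J' (fun h => mB (iota h * u))).
have iu_inj : injective (fun h => iota h * u) by move=> h k /mulIg /iota_inj.
have -> : coset_event u =
    coord_map (fun h => iota h * u) @^-1` (factor_map F @^-1` C).
  apply/seteqP; split => x Ex.
    move=> _ /imfsetP[j /= jJu ->]; rewrite headK //.
    have /andP[jJ /eqP ju] : (j \in J) && (rep j == u) by move: jJu; rewrite !inE.
    have := Ex j jJ ju; rewrite [in bernoulli j x](decomp j) coord_map_bernoulli ju.
    exact.
  move=> j jJ ju; have jJu : j \in Ju by rewrite !inE jJ ju eqxx.
  have : head j \in J' by apply: in_imfset.
  move/Ex; rewrite headK // [in bernoulli j x](decomp j) coord_map_bernoulli ju.
  exact.
have mFC : measurable (factor_map F @^-1` C).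
  rewrite -[X in measurable X]setTI.
  exact: (measurable_factor_map mF measurableT mC).
rewrite (product_measure_coord_map iu_inj Phaar PHhaar mFC) F_push //.
rewrite (QHmu J' (fun h => mB (iota h * u))) big_imfset /=.
  rewrite [RHS]big_fset_condE big_seq [RHS]big_seq.
  by apply: eq_bigr => j jJu; rewrite headK.
by move=> j j' jJ jJ' jj'; rewrite -(headK j) // -(headK j') // jj'.
Qed.
End CosetEvents.

(** * The coding of the free product *)

Section FreeProductCoding.
Variables (R : realType) (G0 G1 : groupType) (K : topGroupType).
Variables (d0 d1 : measure_display).
Variables (Y0 : measurableType d0) (Y1 : measurableType d1).
Local Notation FG := (freeprod G0 G1).
Local Notation KG := (prodspace FG (borel K)).
Local Notation YG := (prodspace FG (Y0 * Y1)%type).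
Hypothesis K2 : @second_countable K.
Hypotheses (cG0 : countable [set: G0]) (cG1 : countable [set: G1]).
Variables (haar : probability (borel K) R).
Variables (mu0 : probability Y0 R) (mu1 : probability Y1 R).
Variables (P0 : probability (prodspace G0 (borel K)) R).
Variables (Q0 : probability (prodspace G0 Y0) R).
Variables (P1 : probability (prodspace G1 (borel K)) R).
Variables (Q1 : probability (prodspace G1 Y1) R).
Variables (P : probability KG R) (Q : probability YG R).
Hypotheses (haarP : is_haar haar)
  (P0haar : is_product_measure haar P0) (Q0mu : is_product_measure mu0 Q0)
  (P1haar : is_product_measure haar P1) (Q1mu : is_product_measure mu1 Q1)
  (Phaar : is_product_measure haar P)
  (Qmu : is_product_measure (mu0 \x mu1)%E Q).
Variables (F0 : prodspace G0 (borel K) -> Y0)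
  (s0 : prodspace G0 Y0 -> prodspace G0 (borel K))
  (A0 : set (prodspace G0 (borel K))) (B0 : set (prodspace G0 Y0)).
Variables (F1 : prodspace G1 (borel K) -> Y1)
  (s1 : prodspace G1 Y1 -> prodspace G1 (borel K))
  (A1 : set (prodspace G1 (borel K))) (B1 : set (prodspace G1 Y1)).
Hypotheses (c0 : coding P0 Q0 F0 s0 A0 B0) (c1 : coding P1 Q1 F1 s1 A1 B1).
Implicit Types (x : KG) (w : YG) (g u : FG).

Local Notation resl := (coord_map (@fpinl G0 G1)).
Local Notation resr := (coord_map (@fpinr G0 G1)).

Definition label_l w : prodspace G0 Y0 := fun h => (w (fpinl G1 h)).1.
Definition label_r w : prodspace G1 Y1 := fun h => (w (fpinr G0 h)).2.

Definition free_F x : Y0 * Y1 := (F0 (resl x), F1 (resr x)).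

Definition free_A : set KG := [set x |
  forall g, A0 (resl (bernoulli g x)) /\ A1 (resr (bernoulli g x))].

Definition free_B : set YG := [set w |
  forall g, B0 (label_l (bernoulli g w)) /\ B1 (label_r (bernoulli g w))].

(* Reads x 1^-1 * x g off the labels, letter by letter along the word g: the
   increment of x over a letter of G0 (resp. G1) is coded by the labels on the
   corresponding coset. *)
Fixpoint decode_word (t : seq (G0 + G1)) w : borel K :=
  if t is l :: t' then decode_word t' w *
    match l with
    | inl h => s0 (label_l (bernoulli (insubd (1 : FG) t') w)) h
    | inr h => s1 (label_r (bernoulli (insubd (1 : FG) t') w)) h
    end
  else 1.

Definition free_s w : KG := fun g => decode_word (fpword g) w.

Lemma measurable_label_l : measurable_fun setT label_l.
Proof.
apply: measurable_funPi => h.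
exact: (measurableT_comp measurable_fst (measurable_proj (fpinl G1 h))).
Qed.

Lemma measurable_label_r : measurable_fun setT label_r.
Proof.
apply: measurable_funPi => h.
exact: (measurableT_comp measurable_snd (measurable_proj (fpinr G0 h))).
Qed.

Lemma measurable_free_s : measurable_fun setT free_s.
Proof.
apply: measurable_funPi => g; rewrite /free_s; elim: (fpword g) => [|l t IH] /=.
  exact: measurable_cst.
apply: measurable_fun_mulg => //; case: l => h.
  have m := measurableT_comp (measurable_proj h) (measurableT_comp (coding_ms c0)
    (measurableT_comp measurable_label_l
      (measurable_bernoulli (insubd (1 : FG) t)))).
  exact: m.
have m := measurableT_comp (measurable_proj h) (measurableT_comp (coding_ms c1)
  (measurableT_comp measurable_label_r
    (measurable_bernoulli (insubd (1 : FG) t)))).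
exact: m.
Qed.

Lemma measurable_free_F : measurable_fun setT free_F.
Proof.
apply: measurable_fun_pair.
  exact: (measurableT_comp (coding_mF c0) (measurable_coord_map _)).
exact: (measurableT_comp (coding_mF c1) (measurable_coord_map _)).
Qed.

(** Turns the recursion on words into one on group elements. As u is shortest in its coset, its word
    is prolonged by the letter h, except for h = 1, where [coding_s1] makes the factor trivial. *)
Lemma free_s_l w h u : headl u = 1 ->
  free_s w (fpinl G1 h * u) = free_s w u * s0 (label_l (bernoulli u w)) h.
Proof.
move=> u1; rewrite /free_s fpinl_mulE.
(* The word of u is reduced, so [insubd] does not fall back on its default 1. *)
have E : insubd (1 : FG) (fpword u) = u by exact: valKd.
move: u1 E (fpwordP u); rewrite /headl; case: (fpword u) => [|[k|k] t] /= u1 E ru.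
- by case: eqP => [->|_] /=; rewrite ?(coding_s1 c0) ?mulg1 ?E.
- by move: ru; rewrite u1 /reduced /= eqxx.
- by case: eqP => [->|_] /=; rewrite ?(coding_s1 c0) ?mulg1 ?E.
Qed.

Lemma free_s_r w h u : headr u = 1 ->
  free_s w (fpinr G0 h * u) = free_s w u * s1 (label_r (bernoulli u w)) h.
Proof.
move=> u1; rewrite /free_s fpinr_mulE.
have E : insubd (1 : FG) (fpword u) = u by exact: valKd.
move: u1 E (fpwordP u); rewrite /headr; case: (fpword u) => [|[k|k] t] /= u1 E ru.
- by case: eqP => [->|_] /=; rewrite ?(coding_s1 c1) ?mulg1 ?E.
- by case: eqP => [->|_] /=; rewrite ?(coding_s1 c1) ?mulg1 ?E.
- by move: ru; rewrite u1 /reduced /= eqxx.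
Qed.

Lemma resl_bernoulli (T : Type) h u (x : prodspace FG T) :
  resl (bernoulli (fpinl G1 h * u) x) = bernoulli h (resl (bernoulli u x)).
Proof. exact: (coord_map_bernoulli (@fpinlM G0 G1)). Qed.

Lemma resr_bernoulli (T : Type) h u (x : prodspace FG T) :
  resr (bernoulli (fpinr G0 h * u) x) = bernoulli h (resr (bernoulli u x)).
Proof. exact: (coord_map_bernoulli (@fpinrM G0 G1)). Qed.

(** Coset by coset the new coding is the given one, which makes the fields of [c0] applicable. *)
Lemma label_l_factor u x :
  label_l (bernoulli u (factor_map free_F x)) = factor_map F0 (resl (bernoulli u x)).
Proof.
apply/funext => h.
by rewrite -[LHS]/(F0 (resl (bernoulli (fpinl G1 h * u) x))) resl_bernoulli.
Qed.

Lemma label_r_factor u x :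
  label_r (bernoulli u (factor_map free_F x)) = factor_map F1 (resr (bernoulli u x)).
Proof.
apply/funext => h.
by rewrite -[LHS]/(F1 (resr (bernoulli (fpinr G0 h * u) x))) resr_bernoulli.
Qed.

(** Induction on the length of g. Unless g = 1, one of its cosets has a shorter representative u;
    the induction hypothesis gives x(1)^-1 x(u), and the inverse coding on that coset supplies
    x(u)^-1 x(g). *)
Lemma free_FK x : free_A x -> free_s (factor_map free_F x) = normalize x.
Proof.
move=> Ax; apply/funext => g; rewrite /normalize /diag_act.
have [n] := ubnP (size g); elim: n g => // n IH g; rewrite ltnS => gn.
have [|lg] := eqVneq (minl g) g; last first.
  have [] : (size (minl g) < size g)%N /\ minr g = g.
    by apply: (@coset_rep_size _ _ false); exact/eqP.
  move=> sz _; rewrite [in LHS](minl_decomp g) free_s_l ?headl_minl //.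
  rewrite IH ?(leq_trans sz) // label_l_factor (coding_FK c0); last first.
    by case: (Ax (minl g)).
  rewrite /normalize /diag_act /coord_map /bernoulli fpinl1 mul1g.
  by rewrite -mulgA mulVKg -minl_decomp.
move=> lg; have [rg|rg] := eqVneq (minr g) g; last first.
  have [] : (size (minr g) < size g)%N /\ minl g = g.
    by apply: (@coset_rep_size _ _ true); exact/eqP.
  move=> sz _; rewrite [in LHS](minr_decomp g) free_s_r ?headr_minr //.
  rewrite IH ?(leq_trans sz) // label_r_factor (coding_FK c1); last first.
    by case: (Ax (minr g)).
  rewrite /normalize /diag_act /coord_map /bernoulli fpinr1 mul1g.
  by rewrite -mulgA mulVKg -minr_decomp.
(* Being shortest in both of its cosets, g has no first letter. *)
have -> : g = 1.
  apply: val_inj => /=; move/(congr1 (@fpword _ _)): lg; move/(congr1 (@fpword _ _)): rg.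
  rewrite fpword_minl fpword_minr; case: (fpword g) => [|[h|h] t] //=.
    by move=> _ /(congr1 size)/eqP; rewrite /= ltn_eqF.
  by move=> /(congr1 size)/eqP; rewrite /= ltn_eqF.
by rewrite mulVg.
Qed.

(** By [free_s_l] the decoded point on the coset of g is a left translate of the one given by [s0];
    the shift by [headl g] moves the base point from [minl g] to g. *)
Lemma resl_free_s w g : resl (bernoulli g (free_s w)) =
  diag_act (free_s w (minl g))
    (bernoulli (headl g) (s0 (label_l (bernoulli (minl g) w)))).
Proof.
apply/funext => h; rewrite /coord_map /bernoulli /diag_act.
by rewrite [in LHS](minl_decomp g) mulgA -fpinlM free_s_l // headl_minl.
Qed.

Lemma resr_free_s w g : resr (bernoulli g (free_s w)) =
  diag_act (free_s w (minr g))
    (bernoulli (headr g) (s1 (label_r (bernoulli (minr g) w)))).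
Proof.
apply/funext => h; rewrite /coord_map /bernoulli /diag_act.
by rewrite [in LHS](minr_decomp g) mulgA -fpinrM free_s_r // headr_minr.
Qed.

(** The translation and the shift in [resl_free_s] are absorbed by the invariance of [A0], and
    likewise for [A1]. *)
Lemma free_BA w : free_B w -> free_A (free_s w).
Proof.
move=> Bw g; rewrite resl_free_s resr_free_s; split.
  apply: (coding_A_diag c0); apply: (coding_A_shift c0); apply: (coding_BA c0).
  by case: (Bw (minl g)).
apply: (coding_A_diag c1); apply: (coding_A_shift c1); apply: (coding_BA c1).
by case: (Bw (minr g)).
Qed.

Lemma free_sK w : free_B w -> factor_map free_F (free_s w) = w.
Proof.
move=> Bw; apply/funext => g; rewrite /factor_map /free_F resl_free_s resr_free_s.
rewrite (coding_F_diag c0) (coding_F_diag c1).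
have [Bl _] := Bw (minl g); have [_ Br] := Bw (minr g).
have := congr1 (fun y => y (headl g)) (coding_sK c0 Bl).
have := congr1 (fun y => y (headr g)) (coding_sK c1 Br).
rewrite /factor_map => -> ->; rewrite /label_l /label_r /bernoulli.
by rewrite -minl_decomp -minr_decomp -surjective_pairing.
Qed.

(** Cylinders with rectangular sides suffice. Such a condition splits into one event per coset of
    either factor; these are independent with known probabilities, and their product regroups to the
    value of [Q]. *)
Lemma free_push (C : set YG) : measurable C -> P (factor_map free_F @^-1` C) = Q C.
Proof.
have mfac := measurable_factor_map measurable_free_F.
pose X : {mfun KG >-> YG} :=
  HB.pack (factor_map free_F) (isMeasurableFun.Build _ _ _ _ _ mfac).
move=> mC; rewrite -[LHS]/(distribution P X C).
apply: (cylinder_unique (measurable_prod_measurableType Y0 Y1)) => //.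
- move=> _ _ [A mA [B mB <-]] [A' mA' [B' mB' <-]]; rewrite -setXI.
  exists (A `&` A'); first exact: measurableI.
  by exists (B `&` B') => //; exact: measurableI.
- by exists setT => //; exists setT => //; rewrite setXTT.
- by rewrite (le_lt_trans (probability_le1 _ _)) ?ltry.
move=> J AB ABM.
have {ABM} /choice[D DP] : forall j, exists D : set Y0 * set Y1,
    [/\ measurable D.1, measurable D.2 & AB j = D.1 `*` D.2].
  by move=> j; have [A mA [B mB <-]] := ABM j; exists (A, B).
have mD1 j : measurable (D j).1 by have [] := DP j.
have mD2 j : measurable (D j).2 by have [] := DP j.
have ABE j : AB j = (D j).1 `*` (D j).2 by have [] := DP j.
pose E (v : bool * FG) : set KG :=
  if v.1 then coset_event (@fpinr G0 G1) (@minr G0 G1) F1 J (fun j => (D j).2) v.2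
  else coset_event (@fpinl G0 G1) (@minl G0 G1) F0 J (fun j => (D j).1) v.2.
(* The cosets of both factors that meet [J], each listed once. *)
pose vs := [seq (false, u) | u <- [fset minl j | j in J]%fset] ++
           [seq (true, u) | u <- [fset minr j | j in J]%fset].
have uvs : uniq vs.
  rewrite cat_uniq !map_inj_uniq ?fset_uniq ?andbT /=; try by move=> u v [].
  by apply/hasPn => _ /mapP[u _ ->]; apply/mapP => -[].
transitivity (P [set x | forall v, v \in vs -> E v x]).
  congr (P _); apply/seteqP; split => x.
    move=> Dx [[] u] _ j jJ ju; have := Dx j jJ; rewrite ABE => -[]; by [].
  move=> Ex j jJ; rewrite ABE; split.
    apply: (Ex (false, minl j)) => //; rewrite mem_cat; apply/orP; left.
    by apply: map_f; apply: in_imfset.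
  apply: (Ex (true, minr j)) => //; rewrite mem_cat; apply/orP; right.
  by apply: map_f; apply: in_imfset.
rewrite (indep_cosets K2 haarP Phaar) //; first last.
- move=> [[] u]; apply: coset_event_dep.
    exact: minr_mul.
  exact: minl_mul.
- move=> [[] u] k x; apply: coset_event_diag; first exact: (coding_F_diag c1).
  exact: (coding_F_diag c0).
- move=> [[] u]; apply: measurable_coset_event => //; first exact: (coding_mF c1).
  exact: (coding_mF c0).
have mAB j : measurable (AB j) by rewrite ABE; exact: measurableX.
apply: etrans (esym (Qmu J mAB)).
rewrite (eq_bigr (fun j => mu0 (D j).1 * mu1 (D j).2)%E); last first.
  by move=> j _; rewrite ABE product_measure1E.
(* The [mu0] factors are grouped by cosets of [G0], the [mu1] factors by cosets of [G1]. *)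
rewrite big_split big_cat !big_map /=; congr (_ * _)%E.
  rewrite [RHS](partition_big_imfset _ (@minl G0 G1)); apply: eq_bigr => u _.
  exact: (coset_event_prob (@fpinlM G0 G1) (@fpinl_inj G0 G1) (@minl_decomp G0 G1)
    Phaar P0haar Q0mu (coding_mF c0) (coding_push c0) _ mD1).
rewrite [RHS](partition_big_imfset _ (@minr G0 G1)); apply: eq_bigr => u _.
exact: (coset_event_prob (@fpinrM G0 G1) (@fpinr_inj G0 G1) (@minr_decomp G0 G1)
  Phaar P1haar Q1mu (coding_mF c1) (coding_push c1) _ mD2).
Qed.

Lemma free_coding : coding P Q free_F free_s free_A free_B.
Proof.
have cFG := countable_freeprod cG0 cG1.
have mresl g : measurable_fun setT (fun x => resl (bernoulli g x)).
  exact: (measurableT_comp (measurable_coord_map _) (measurable_bernoulli g)).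
have mresr g : measurable_fun setT (fun x => resr (bernoulli g x)).
  exact: (measurableT_comp (measurable_coord_map _) (measurable_bernoulli g)).
have mlab_l g : measurable_fun setT (fun w => label_l (bernoulli g w)).
  exact: (measurableT_comp measurable_label_l (measurable_bernoulli g)).
have mlab_r g : measurable_fun setT (fun w => label_r (bernoulli g w)).
  exact: (measurableT_comp measurable_label_r (measurable_bernoulli g)).
split.
- exact: measurable_free_F.
- exact: measurable_free_s.
- apply: measurable_forall => // g; apply: measurableI.
    by rewrite -[X in measurable X]setTI; exact: (mresl g measurableT _ (coding_mA c0)).
  by rewrite -[X in measurable X]setTI; exact: (mresr g measurableT _ (coding_mA c1)).
- apply: measurable_forall => // g; apply: measurableI.
    by rewrite -[X in measurable X]setTI; exact: (mlab_l g measurableT _ (coding_mB c0)).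
  by rewrite -[X in measurable X]setTI; exact: (mlab_r g measurableT _ (coding_mB c1)).
(* The restriction of x to a coset has law [P0] or [P1], so each g fails the condition of [free_A]
   with probability zero, and there are countably many g. *)
- have inj_l g : injective (fun h => fpinl G1 h * g).
    by move=> h k /mulIg /fpinl_inj.
  have inj_r g : injective (fun h => fpinr G0 h * g).
    by move=> h k /mulIg /fpinr_inj.
  have n_l g : P.-negligible (coord_map (fun h => fpinl G1 h * g) @^-1` (~` A0)).
    exact: (negligible_coord_map (inj_l g) Phaar P0haar
      (measurableC (coding_mA c0)) (coding_A c0)).
  have n_r g : P.-negligible (coord_map (fun h => fpinr G0 h * g) @^-1` (~` A1)).
    exact: (negligible_coord_map (inj_r g) Phaar P1haar
      (measurableC (coding_mA c1)) (coding_A c1)).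
  have := negligible_exists cFG (fun g => negligibleU (n_l g) (n_r g)).
  apply: negligibleS => x nAx; apply: contrapT => nex; apply: nAx => g.
  by split; apply: contrapT => nA; apply: nex; exists g; [left|right].
- move=> k x; rewrite /free_F.
  rewrite -[resl _]/(diag_act k (resl x)) -[resr _]/(diag_act k (resr x)).
  by rewrite (coding_F_diag c0) (coding_F_diag c1).
- move=> k x Ax g; have [A0x A1x] := Ax g; split.
    exact: (coding_A_diag c0 k A0x).
  exact: (coding_A_diag c1 k A1x).
- by move=> g x Ax h; rewrite -bernoulliM; exact: Ax.
- move=> x Ax g; rewrite label_l_factor label_r_factor; have [A0x A1x] := Ax g.
  by split; [exact: (coding_AB c0)|exact: (coding_AB c1)].
- exact: free_BA.
- exact: free_FK.
- exact: free_sK.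
- by [].
- exact: free_push.
Qed.
End FreeProductCoding.

Theorem theorem9 (R : realType) (G0 G1 : groupType) (K : topGroupType)
  (haar : probability (borel K) R)
  (d0 d1 : measure_display) (Y0 : measurableType d0) (Y1 : measurableType d1)
  (mu0 : probability Y0 R) (mu1 : probability Y1 R)
  (kappa0 : probability (prodspace G0 (borel K)) R)
  (nu0 : probability (prodspace G0 Y0) R)
  (kappa1 : probability (prodspace G1 (borel K)) R)
  (nu1 : probability (prodspace G1 Y1) R)
  (kappa : probability (prodspace (freeprod G0 G1) (borel K)) R)
  (nu : probability (prodspace (freeprod G0 G1) (Y0 * Y1)%type) R) :
  countable [set: G0] -> countable [set: G1] ->
  compact [set: K] -> hausdorff_space K -> @second_countable K ->
  (exists k : K, k != 1) ->
  is_haar haar ->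
  standard_borel R Y0 -> standard_borel R Y1 ->
  is_product_measure haar kappa0 -> is_product_measure mu0 nu0 ->
  is_product_measure haar kappa1 -> is_product_measure mu1 nu1 ->
  is_product_measure haar kappa -> is_product_measure (mu0 \x mu1)%E nu ->
  isomorphic_actions (quot_prob kappa0) (@quot_act G0 K)
                     nu0 (@bernoulli G0 Y0) ->
  isomorphic_actions (quot_prob kappa1) (@quot_act G1 K)
                     nu1 (@bernoulli G1 Y1) ->
  isomorphic_actions (quot_prob kappa) (@quot_act (freeprod G0 G1) K)
                     nu (@bernoulli (freeprod G0 G1) (Y0 * Y1)%type).
Proof.
move=> cG0 cG1 _ _ K2 _ haarP _ _ P0haar Q0mu P1haar Q1mu Phaar Qmu iso0 iso1.
have [F0 [s0 [A0 [B0 c0]]]] := isomorphic_coding cG0 K2 P0haar iso0.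
have [F1 [s1 [A1 [B1 c1]]]] := isomorphic_coding cG1 K2 P1haar iso1.
apply: coding_isomorphic.
exact: (free_coding K2 cG0 cG1 haarP P0haar Q0mu P1haar Q1mu Phaar Qmu c0 c1).
Qed.
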